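(* For every graph $G$, $\mathring{s}(G)=\chi_{\mathrm{SP}}(G)$ if and only if every component of $G$ is complete.
   Context: All graphs are finite and simple. The slow-coloring game on a graph $G$ is played by Lister and Painter. On each round, Lister marks a nonempty subset $M$ of the uncolored vertices, scoring $|M|$ points; Painter then colors (with a new color) a subset of $M$ that is independent in $G$. The game ends when all vertices are colored. Painter wants to minimize the total score and Lister wants to maximize it. The sum-color cost $\mathring{s}(G)$ is the total score under optimal play by both players (the score that each player can guarantee doing no worse than). For $f:V(G)\to\mathbb{N}$ (positive integers), the $f$-painting game on $G$ is played with the same moves: on each round Lister marks a nonempty set $M$ of uncolored vertices and Painter colors an independent subset of $M$. Lister wins by marking some vertex $v$ more than $f(v)$ times; Painter wins by coloring all the vertices before that happens. $G$ is $f$-paintable if Painter has a winning strategy. The sum-paintability $\chi_{\mathrm{SP}}(G)$ is the minimum of $\sum_{v\in V(G)} f(v)$ over all $f$ such that $G$ is $f$-paintable. *)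

(* Defs.v *)
From HB Require Import structures.
From mathcomp Require Import all_boot.
From mathcomp Require Import boolp.

Set Implicit Arguments.
Unset Strict Implicit.
Unset Printing Implicit Defensive.

Record sgraph := SGraph {
  vertex :> finType;
  adj : rel vertex;
  adj_sym : symmetric adj;
  adj_irr : irreflexive adj }.

Definition independent (G : sgraph) (I : {set G}) : Prop :=
  {in I &, forall x y, ~~ adj x y}.

Definition complete_on (G : sgraph) (A : {set G}) : Prop :=
  {in A &, forall x y, x != y -> adj x y}.

Definition components (G : sgraph) : {set {set G}} :=
  equivalence_partition (connect (@adj G)) [set: G].

(* In both games, [U] is the set of uncolored vertices. *)
Definition legal_mark (G : sgraph) (U M : {set G}) : Prop :=
  M != set0 /\ M \subset U.

Definition legal_color (G : sgraph) (M I : {set G}) : Prop :=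
  I \subset M /\ independent I.

(* Slow-coloring game at the position with current score [s]: Painter can
   force the game to end with total score at most [k].  [resp] is Painter's
   reply to each mark.  Painter may color nothing; since every round scores at
   least one point, the bound [k] forces termination. *)
Inductive painter_guarantees (G : sgraph) (k : nat) :
    nat -> {set G} -> Prop :=
  PainterGuarantees (s : nat) (U : {set G}) (resp : {set G} -> {set G}) :
    (forall M, legal_mark U M ->
       s + #|M| <= k /\ legal_color M (resp M)) ->
    (forall M, legal_mark U M ->
       painter_guarantees k (s + #|M|) (U :\: resp M)) ->
    painter_guarantees k s U.

(* Lister can force a total score of at least [k]; as the score never
   decreases, it suffices to reach [k] at some point. *)
Inductive lister_guarantees (G : sgraph) (k : nat) :
    nat -> {set G} -> Prop :=
| ListerReached (s : nat) (U : {set G}) :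
    k <= s -> lister_guarantees k s U
| ListerMarks (s : nat) (U M : {set G}) :
    legal_mark U M ->
    (forall I, legal_color M I ->
       lister_guarantees k (s + #|M|) (U :\: I)) ->
    lister_guarantees k s U.

Definition slow_coloring_value (G : sgraph) (k : nat) : Prop :=
  painter_guarantees k 0 [set: G] /\ lister_guarantees k 0 [set: G].

(* [f]-painting game at the position where each vertex [v] has been marked
   [m v] times so far: Painter has a winning strategy. *)
Inductive painter_wins (G : sgraph) (f : G -> nat) :
    (G -> nat) -> {set G} -> Prop :=
  PainterWins (m : G -> nat) (U : {set G}) (resp : {set G} -> {set G}) :
    (forall M, legal_mark U M ->
       {in M, forall v, m v + 1 <= f v} /\ legal_color M (resp M)) ->
    (forall M, legal_mark U M ->
       painter_wins f (fun v => m v + (v \in M)) (U :\: resp M)) ->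
    painter_wins f m U.

Definition paintable (G : sgraph) (f : G -> nat) : Prop :=
  painter_wins f (fun=> 0) [set: G].

Definition paintable_sum (G : sgraph) (n : nat) : Prop :=
  exists f : G -> nat,
    [/\ forall v, 0 < f v, paintable f & \sum_(v : G) f v = n].

(* The reply coloring a single marked vertex. *)
Lemma color1_resp (G : sgraph) : exists resp : {set G} -> {set G},
  forall U M, legal_mark U M ->
    legal_color M (resp M) /\ #|U :\: resp M| < #|U|.
Proof.
exists (fun M : {set G} => if [pick x in M] is Some x then [set x] else set0) => U M LM.
case: pickP => [x xM|M0]; last by case: LM => /set0Pn[x]; rewrite M0.
split.
  split; first by rewrite sub1set.
  by move=> a b /set1P-> /set1P->; rewrite adj_irr.
case: LM => _ MU; rewrite [X in _ < X](cardsD1 x) (subsetP MU _ xM).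
by rewrite add1n.
Qed.

Lemma painter_guarantees_sqr (G : sgraph) (k s : nat) (U : {set G}) :
  s + #|U| * #|U| <= k -> painter_guarantees k s U.
Proof.
have [resp respP] := color1_resp G.
have [n] := ubnP #|U|; elim: n s U => // n IHn s U ltUn le_k.
apply: (@PainterGuarantees _ _ _ _ resp) => M LM;
  have [LI ltU] := respP _ _ LM; have leMU := subset_leq_card LM.2.
  split=> //; apply: leq_trans le_k; rewrite leq_add2l (leq_trans leMU) //.
  by rewrite leq_pmull // (leq_ltn_trans _ ltU).
apply: IHn; first exact: leq_trans ltU ltUn.
apply: leq_trans le_k; rewrite -addnA leq_add2l.
rewrite -[#|U| in leqRHS](ltn_predK ltU) mulSn (ltn_predK ltU) leq_add //.
have leU' : #|U :\: resp M| <= #|U|.-1 by rewrite -ltnS (ltn_predK ltU).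
exact: leq_mul leU' (ltnW ltU).
Qed.

Lemma slow_coloring_determined (G : sgraph) (k s : nat) (U : {set G}) :
  painter_guarantees k s U \/ lister_guarantees k.+1 s U.
Proof.
have [n] := ubnP (k.+1 - s); elim: n s U => // n IHn s U lt_n.
have [lt_ks|le_sk] := ltnP k s; first by right; apply: ListerReached.
have [[M LM noI]|H] := pselect (exists2 M, legal_mark U M &
  forall I, s + #|M| <= k -> legal_color M I ->
    ~ painter_guarantees k (s + #|M|) (U :\: I)).
  right; apply: (ListerMarks LM) => I LI.
  have [lt_k|le_k] := ltnP k (s + #|M|); first exact: ListerReached.
  have [||//] := IHn (s + #|M|) (U :\: I); last by move/(noI _ le_k LI).
  have M0 : 0 < #|M| by rewrite card_gt0 LM.1.
  rewrite ltnS in lt_n; rewrite subnDA; apply: leq_trans lt_n.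
  by rewrite ltn_subrL M0 subn_gt0 ltnS.
left.
have /choice[resp respP] : forall M, exists I, legal_mark U M ->
    [/\ s + #|M| <= k, legal_color M I &
        painter_guarantees k (s + #|M|) (U :\: I)].
  move=> M; have [LM|nLM] := pselect (legal_mark U M); last by exists set0.
  apply: contrapT => /forallNP nI; apply: H; exists M => // I le_k LI PI.
  by apply: (nI I).
by apply: (@PainterGuarantees _ _ _ _ resp) => M /respP[].
Qed.

Lemma slow_coloring_le (G : sgraph) (k l s : nat) (U : {set G}) : s <= k ->
  painter_guarantees k s U -> lister_guarantees l s U -> l <= k.
Proof.
move=> le_sk PG LG; elim: LG le_sk PG => {s U}[s U le_ls le_sk _|s U M LM _ IH].
  exact: leq_trans le_sk.
move=> _ PG; case: PG LM IH => {}s {}U resp respP PG LM IH.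
by have [le_k LI] := respP _ LM; apply: (IH (resp M)) => //; apply: PG.
Qed.

Lemma slow_coloring_value_uniq (G : sgraph) (k l : nat) :
  slow_coloring_value G k -> slow_coloring_value G l -> k = l.
Proof.
move=> [Pk Lk] [Pl Ll]; apply/eqP; rewrite eqn_leq.
by rewrite (slow_coloring_le _ Pl Lk) // (slow_coloring_le _ Pk Ll).
Qed.

Lemma slow_coloring_value_ex (G : sgraph) :
  exists k, slow_coloring_value G k.
Proof.
have exk : exists k, `[< painter_guarantees k 0 [set: G] >].
  by exists (#|[set: G]| * #|[set: G]|); apply/asboolP/painter_guarantees_sqr.
exists (ex_minn exk); case: ex_minnP => k /asboolP Pk min_k; split=> //.
case: k Pk min_k => [_ _|k _ min_k]; first exact: ListerReached.
have [/asboolP/min_k|//] := slow_coloring_determined k 0 [set: G].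
by rewrite ltnn.
Qed.

Lemma paintable_sum_ex (G : sgraph) : exists n, `[< paintable_sum G n >].
Proof.
have [resp respP] := color1_resp G.
pose f (v : G) := #|G|.
exists (\sum_(v : G) f v); apply/asboolP; exists f; split=> // [v|].
  by rewrite /f; apply/card_gt0P; exists v.
suff win m (U : {set G}) : {in U, forall v, m v + #|U| <= f v} ->
    painter_wins f m U by apply: win => v _; rewrite cardsT.
have [n] := ubnP #|U|; elim: n m U => // n IHn m U ltUn le_f.
apply: (@PainterWins _ _ _ _ resp) => M LM; have [LI ltU] := respP _ _ LM.
  split=> // v vM; have vU := subsetP LM.2 _ vM.
  apply: leq_trans (le_f _ vU); rewrite leq_add2l.
  exact: leq_ltn_trans ltU.
apply: IHn => [|v /setDP[vU _]]; first exact: leq_trans ltU ltUn.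
apply: leq_trans (le_f _ vU); rewrite -addnA leq_add2l.
by apply: leq_trans ltU; rewrite -add1n leq_add2r leq_b1.
Qed.

Definition sum_color_cost (G : sgraph) : nat :=
  sval (cid (slow_coloring_value_ex G)).

Lemma sum_color_costP (G : sgraph) : slow_coloring_value G (sum_color_cost G).
Proof. exact: svalP. Qed.

Definition sum_paintability (G : sgraph) : nat := ex_minn (paintable_sum_ex G).

Lemma sum_paintabilityP (G : sgraph) : paintable_sum G (sum_paintability G).
Proof. by rewrite /sum_paintability; case: ex_minnP => n /asboolP. Qed.

Lemma sum_paintability_min (G : sgraph) (f : G -> nat) :
  (forall v, 0 < f v) -> paintable f -> sum_paintability G <= \sum_(v : G) f v.
Proof.
rewrite /sum_paintability => f0 Pf; case: ex_minnP => n _; apply.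
by apply/asboolP; exists f.
Qed.

(* Main.v *)
Require Import Defs.
From mathcomp Require Import all_boot.
From mathcomp Require Import boolp zify.

Set Implicit Arguments.
Unset Strict Implicit.
Unset Printing Implicit Defensive.

(** The invariant that decides equality is the number of vertices plus the
number of edges, [vertex_edge_count], together with three comparisons.

Under a winning Painter strategy in the f-painting game, each vertex v is
marked at most f(v) times, so the strategy also keeps the slow-coloring score
at or below the sum of f ([paintable_on_painter_within]).  Coloring greedily
along a vertex order, with f(v) one more than the number of earlier neighbors
of v, shows that the sum-paintability is at most the number of vertices plus
the number of edges ([paintable_on_vertex_edge_count]).

If every component is complete, Lister marks a whole remaining component each
time; Painter colors at most one vertex of it, and deleting that vertex
lowers the count by exactly the score of the round
([vertex_edge_count_le]).  Hence the slow-coloring value is at least the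
count, and all three numbers coincide.

If some component is not complete, then the graph has an induced path on three
vertices, where the count is 5 but Painter holds the score to 4.  Putting back
a vertex of degree d costs Painter at most 1 + d, which is also the increase
of the count, so the slow-coloring value lies strictly below the count of the
whole graph ([painter_within_induced_path3]).  It remains to exclude that the
sum-paintability drops to the same value, and for this
[paintable_on_dichotomy] shows that, for every f with a Painter win, either
the sum of f is at least the count or Painter keeps the score strictly below
the sum of f.  The proof deletes vertices with f(v) = 1, each of which accounts
for 1 + d of the sum; once all values are at least 2, every vertex that
Painter colors in the first round is colored before its quota is used up,
which leaves slack in the score. *)

(** * Playing one round *)

(** Only the difference between the bound and the current score matters, so
positions are normalized to score 0 with the bound decreasing; this makes
induction on the bound available. *)
Definition painter_within (G : sgraph) (k : nat) (U : {set G}) : Prop :=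
  painter_guarantees k 0 U.

(** The same normalization for the painting game: [f v] is the number of marks
that [v] can still take. *)
Definition paintable_on (G : sgraph) (f : G -> nat) (U : {set G}) : Prop :=
  painter_wins f (fun=> 0) U.

Lemma legal_color0 (G : sgraph) (M : {set G}) : legal_color M set0.
Proof. by split; [apply: sub0set|move=> x y; rewrite inE]. Qed.

Lemma painter_guarantees_shift (G : sgraph) (k s : nat) (U : {set G}) :
  painter_guarantees k s U ->
  forall k' s', s' + k <= k' + s -> painter_guarantees k' s' U.
Proof.
elim=> {}s {}U resp respP _ IH k' s' le_k.
apply: (@PainterGuarantees _ _ _ _ resp) => M LM; have [le_s LI] := respP _ LM.
  by split=> //; lia.
by apply: (IH _ LM); lia.
Qed.

Lemma painter_guarantees_reply (G : sgraph) (k s : nat) (U M : {set G}) :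
  painter_guarantees k s U -> legal_mark U M ->
  s + #|M| <= k /\
  exists2 I, legal_color M I & painter_guarantees k (s + #|M|) (U :\: I).
Proof.
case=> {}s {}U resp respP PU LM; have [le_k LI] := respP _ LM.
by split=> //; exists (resp M) => //; apply: PU.
Qed.

Lemma painter_within_le (G : sgraph) (k k' : nat) (U : {set G}) :
  k <= k' -> painter_within k U -> painter_within k' U.
Proof. by move=> le_k /painter_guarantees_shift; apply; rewrite addn0. Qed.

Lemma painter_withinI (G : sgraph) (k : nat) (U : {set G}) :
  (forall M, legal_mark U M -> #|M| <= k /\
     exists2 I, legal_color M I & painter_within (k - #|M|) (U :\: I)) ->
  painter_within k U.
Proof.
move=> H.
have /choice[resp respP] : forall M, exists I, legal_mark U M ->
    [/\ #|M| <= k, legal_color M I & painter_within (k - #|M|) (U :\: I)].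
  move=> M; have [LM|nLM] := pselect (legal_mark U M); last by exists set0.
  by have [le_k [I]] := H M LM; exists I.
apply: (@PainterGuarantees _ _ _ _ resp) => M /respP[le_k LI PI] //.
by apply: (painter_guarantees_shift PI); lia.
Qed.

(** An empty [M], which is no legal mark, is admitted: Painter then passes.
This spares a case distinction when a strategy is applied to a part of the
actual mark. *)
Lemma painter_withinE (G : sgraph) (k : nat) (U M : {set G}) :
  painter_within k U -> M \subset U ->
  #|M| <= k /\
  exists2 I, legal_color M I & painter_within (k - #|M|) (U :\: I).
Proof.
move=> PU MU; have [->|M0] := eqVneq M set0.
  rewrite cards0 subn0; split=> //; exists set0; rewrite ?setD0 //.
  exact: legal_color0.
have [//|le_k [I LI PI]] := painter_guarantees_reply PU (M := M).
by split=> //; exists I => //; apply: (painter_guarantees_shift PI); lia.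
Qed.

Lemma painter_wins_shift (G : sgraph) (f m : G -> nat) (U : {set G}) :
  painter_wins f m U ->
  forall g m', {in U, forall v, m' v + f v <= g v + m v} -> painter_wins g m' U.
Proof.
elim=> {}m {}U resp respP _ IH g m' le_g.
apply: (@PainterWins _ _ _ _ resp) => M LM; have [le_f LI] := respP _ LM.
  split=> // v vM.
  by have := le_f _ vM; have := le_g _ (subsetP LM.2 _ vM); lia.
by apply: (IH _ LM) => v /setDP[/le_g le_v _]; lia.
Qed.

Lemma painter_wins_reply (G : sgraph) (f m : G -> nat) (U M : {set G}) :
  painter_wins f m U -> legal_mark U M ->
  {in M, forall v, m v + 1 <= f v} /\
  exists2 I, legal_color M I &
    painter_wins f (fun v => m v + (v \in M)) (U :\: I).
Proof.
case=> {}m {}U resp respP PU LM; have [le_f LI] := respP _ LM.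
by split=> //; exists (resp M) => //; apply: PU.
Qed.

Lemma paintable_on_le (G : sgraph) (f g : G -> nat) (U : {set G}) :
  {in U, forall v, f v <= g v} -> paintable_on f U -> paintable_on g U.
Proof. by move=> le_f /painter_wins_shift; apply=> v /le_f; rewrite addn0. Qed.

Lemma paintable_onI (G : sgraph) (f : G -> nat) (U : {set G}) :
  (forall M, legal_mark U M -> {in M, forall v, 0 < f v} /\
     exists2 I, legal_color M I &
       paintable_on (fun v => f v - (v \in M)) (U :\: I)) ->
  paintable_on f U.
Proof.
move=> H.
have /choice[resp respP] : forall M, exists I, legal_mark U M ->
    [/\ {in M, forall v, 0 < f v}, legal_color M I &
        paintable_on (fun v => f v - (v \in M)) (U :\: I)].
  move=> M; have [LM|nLM] := pselect (legal_mark U M); last by exists set0.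
  by have [f0 [I]] := H M LM; exists I.
apply: (@PainterWins _ _ _ _ resp) => M /respP[f0 LI PI] //.
apply: (painter_wins_shift PI) => v _.
by case: (boolP (v \in M)) => [/f0|] /=; lia.
Qed.

Lemma paintable_onE (G : sgraph) (f : G -> nat) (U M : {set G}) :
  paintable_on f U -> M \subset U ->
  {in M, forall v, 0 < f v} /\
  exists2 I, legal_color M I &
    paintable_on (fun v => f v - (v \in M)) (U :\: I).
Proof.
move=> PU MU; have [M0|M0] := eqVneq M set0.
  split; first by rewrite M0 => v; rewrite inE.
  exists set0; first exact: legal_color0.
  by rewrite setD0; apply: paintable_on_le PU => v _; rewrite M0 inE subn0.
have [//|f0 [I LI PI]] := painter_wins_reply PU (M := M).
split=> [v /f0|]; first by lia.
by exists I => //; apply: (painter_wins_shift PI) => v _; lia.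
Qed.

(** A vertex with no mark left would lose the game at once for Painter. *)
Lemma paintable_on_gt0 (G : sgraph) (f : G -> nat) (U : {set G}) :
  paintable_on f U -> {in U, forall v, 0 < f v}.
Proof. by move=> /paintable_onE/(_ (subxx U))[]. Qed.

(** * Vertices plus edges *)

Definition nbrs (G : sgraph) (U : {set G}) (v : G) : {set G} :=
  [set x in U | adj v x].

Definition edges (G : sgraph) (U : {set G}) : {set {set G}} :=
  [set e in powerset U | [exists x, exists y, adj x y && (e == [set x; y])]].

Definition vertex_edge_count (G : sgraph) (U : {set G}) : nat :=
  #|U| + #|edges U|.

Lemma adj_neq (G : sgraph) (x y : G) : adj x y -> x != y.
Proof. by apply: contraTneq => ->; rewrite adj_irr. Qed.

Lemma vertex_edge_count0 (G : sgraph) :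
  vertex_edge_count (set0 : {set G}) = 0.
Proof.
rewrite /vertex_edge_count cards0 add0n; apply/eqP; rewrite cards_eq0.
apply/eqP/setP => e; rewrite !inE subset0; apply/negP => /andP[/eqP->].
move=> /existsP[x /existsP[y /andP[_ /eqP/setP/(_ x)]]].
by rewrite !inE eqxx.
Qed.

(** The edges of [U] through [v] are the pairs [{v, y}] with [y] a neighbor of
[v], and the others are the edges that survive the deletion of [v]. *)
Lemma card_edgesD1 (G : sgraph) (U : {set G}) (v : G) : v \in U ->
  #|edges U| = #|edges (U :\ v)| + #|nbrs U v|.
Proof.
move=> vU; rewrite -(cardsID [set e : {set G} | v \in e] (edges U)) addnC.
congr (_ + _).
  by apply: eq_card => e; rewrite !inE subsetD1 -andbA andbCA.
have inj : {in nbrs U v &, injective (fun y => [set v; y])}.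
  move=> y z; rewrite !inE => /andP[_ vy] _ /setP/(_ y).
  by rewrite !inE eqxx orbT eq_sym (negPf (adj_neq vy)) => /esym/eqP.
rewrite -(card_in_imset inj); apply: eq_card => e; rewrite !inE.
apply/andP/imsetP => [[/andP[eU]]|[y]].
  move=> /existsP[x /existsP[y /andP[xy /eqP e_xy]]]; rewrite e_xy in eU *.
  have /andP[xU yU] : (x \in U) && (y \in U) by rewrite -!sub1set -subUset.
  rewrite !inE => /orP[]/eqP->; first by exists y; rewrite // inE yU.
  by exists x; rewrite 1?setUC // inE xU adj_sym.
rewrite inE => /andP[yU vy] ->; rewrite subUset !sub1set vU yU !inE eqxx.
by split=> //; apply/existsP; exists v; apply/existsP; exists y; rewrite vy eqxx.
Qed.

Lemma vertex_edge_countD1 (G : sgraph) (U : {set G}) (v : G) : v \in U ->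
  vertex_edge_count U = vertex_edge_count (U :\ v) + 1 + #|nbrs U v|.
Proof.
move=> vU; rewrite /vertex_edge_count (card_edgesD1 vU) (cardsD1 v U) vU.
lia.
Qed.

(** * Putting back one vertex *)

(** The reply shared by both games: when [v] is marked, color it, and answer in
the graph without [v] as if its marked neighbors had not been marked. *)
Lemma legal_color_extend (G : sgraph) (M I : {set G}) (v : G) : v \in M ->
  legal_color ((M :\ v) :\: nbrs M v) I -> legal_color M (v |: I).
Proof.
move=> vM [IM indI].
have IP x : x \in I -> (x \in M) && ~~ adj v x.
  by move/(subsetP IM); rewrite !inE => /and3P[h _ xM]; rewrite xM in h *.
split.
  by rewrite subUset sub1set vM; apply/subsetP => x /IP/andP[].
move=> x y /setU1P[->|xI] /setU1P[->|yI]; first by rewrite adj_irr.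
- by have /andP[] := IP _ yI.
- by rewrite adj_sym; have /andP[] := IP _ xI.
- exact: indI.
Qed.

(** As long as [v] is unmarked, Painter plays as if it were absent.  The first
round that marks [v] also colors it, so the marks hidden from the strategy
for the rest, on [v] and on its neighbors, are counted only once. *)
Lemma painter_within_extend (G : sgraph) (k d : nat) (U : {set G}) (v : G) :
  v \in U -> #|nbrs U v| <= d -> painter_within k (U :\ v) ->
  painter_within (k + 1 + d) U.
Proof.
have [n] := ubnP k; elim: n k U => // n IHn k U lt_kn vU le_d PU.
apply: painter_withinI => M [M0 MU].
have [vM|vM] := boolP (v \in M).
  have M'U : (M :\ v) :\: nbrs M v \subset U :\ v.
    by apply: subset_trans (subsetDl _ _) (setSD _ MU).
  have [le_k [I LI PI]] := painter_withinE PU M'U.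
  have le_M : #|M| <= #|(M :\ v) :\: nbrs M v| + 1 + d.
    have le_N : #|nbrs M v| <= d.
      apply: leq_trans le_d; apply/subset_leq_card/subsetP => x.
      by rewrite !inE => /andP[/(subsetP MU)-> ->].
    rewrite (cardsD1 v M) vM -(cardsID (nbrs M v) (M :\ v)).
    have := subset_leq_card (subsetIr (M :\ v) (nbrs M v)); lia.
  split; first by lia.
  exists (v |: I); first exact: legal_color_extend.
  rewrite -setDDl; apply: painter_within_le PI; lia.
have MU' : M \subset U :\ v by rewrite subsetD1 MU.
have [le_k [I LI PI]] := painter_withinE PU MU'.
have M_gt0 : 0 < #|M| by rewrite card_gt0.
split; first by lia.
exists I => //.
have -> : k + 1 + d - #|M| = (k - #|M|) + 1 + d by lia.
apply: IHn; first by lia.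
- by rewrite inE vU andbT; apply: contra vM; apply: (subsetP LI.1).
- apply: leq_trans le_d; apply/subset_leq_card/subsetP => x.
  by rewrite !inE => /andP[/andP[_ ->] ->].
- by rewrite setDDl setUC -setDDl.
Qed.

Lemma sum_mark (G : sgraph) (f : G -> nat) (U M : {set G}) :
  M \subset U -> {in M, forall v, 0 < f v} ->
  \sum_(v in U) f v = \sum_(v in U) (f v - (v \in M)) + #|M|.
Proof.
move=> MU f0; rewrite -sum1_card.
have -> : \sum_(v in M) 1 = \sum_(v in U) (v \in M).
  rewrite [RHS](big_setID M) /= (setIidPr MU) [X in _ + X]big1 ?addn0.
    by apply: eq_bigr => v ->.
  by move=> v /setDP[_ /negPf->].
rewrite -big_split; apply: eq_bigr => v _ /=.
by case: (boolP (v \in M)) => [/f0|]; lia.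
Qed.

Lemma sum_setD (G : sgraph) (f : G -> nat) (U I : {set G}) : I \subset U ->
  \sum_(v in U) f v = \sum_(v in I) f v + \sum_(v in U :\: I) f v.
Proof. by move=> IU; rewrite (big_setID I) /= (setIidPr IU). Qed.

(** By the same strategy, one mark on [v] and one extra mark on each neighbor
are enough, since the neighbors are passed over only in the round that colors
[v]. *)
Lemma paintable_on_extend (G : sgraph) (f g : G -> nat) (U : {set G}) (v : G) :
  v \in U -> paintable_on f (U :\ v) -> 0 < g v ->
  {in U :\ v, forall x, f x + adj v x <= g x} ->
  paintable_on g U.
Proof.
have [n] := ubnP (\sum_(x in U :\ v) f x).
elim: n f g U => // n IHn f g U lt_n vU PU gv le_g.
apply: paintable_onI => M [M0 MU].
have MD x : x \in M -> x != v -> x \in U :\ v.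
  by move=> /(subsetP MU) xU xv; rewrite !inE xv.
split=> [x xM|].
  have [->//|xv] := eqVneq x v; have xU := MD _ xM xv.
  by have := le_g _ xU; have := paintable_on_gt0 PU xU; lia.
have [vM|vM] := boolP (v \in M).
  have M'U : (M :\ v) :\: nbrs M v \subset U :\ v.
    by apply: subset_trans (subsetDl _ _) (setSD _ MU).
  have [_ [I LI PI]] := paintable_onE PU M'U.
  exists (v |: I); first exact: legal_color_extend.
  rewrite -setDDl; apply: paintable_on_le PI => x /setDP[xU _].
  have := le_g _ xU; move: xU; rewrite !inE => /andP[-> _] /=.
  by case: (x \in M); case: (adj v x) => /=; lia.
have MU' : M \subset U :\ v by rewrite subsetD1 MU.
have [f0 [I LI PI]] := paintable_onE PU MU'; exists I => //.
have M_gt0 : 0 < #|M| by rewrite card_gt0.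
have PI' : paintable_on (fun x => f x - (x \in M)) ((U :\: I) :\ v).
  by rewrite setDDl setUC -setDDl.
apply: IHn PI' _ _.
- have := sum_mark MU' f0.
  have := sum_setD (fun x => f x - (x \in M)) (subset_trans LI.1 MU').
  rewrite setDDl setUC -setDDl; lia.
- by rewrite inE vU andbT; apply: contra vM; apply: (subsetP LI.1).
- by rewrite (negPf vM) subn0.
- move=> x; rewrite setDDl setUC -setDDl => /setDP[xU _].
  have := le_g _ xU; case: (boolP (x \in M)) => [xM|_] /=; last by lia.
  have := f0 _ xM; lia.
Qed.

Lemma paintable_on_vertex_edge_count (G : sgraph) (U : {set G}) :
  exists2 f : G -> nat, paintable_on f U &
    \sum_(v in U) f v = vertex_edge_count U.
Proof.
have [n] := ubnP #|U|; elim: n U => // n IHn U ltUn.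
have [->|[v vU]] := set_0Vmem U.
  exists (fun=> 0); last by rewrite big_set0 vertex_edge_count0.
  by apply: paintable_onI => M [/negP M0]; rewrite subset0.
have [|f Pf sum_f] := IHn (U :\ v); first by rewrite (cardsD1 v U) vU in ltUn.
exists (fun x => if x == v then 1 else f x + adj v x).
  apply: (paintable_on_extend vU Pf); first by rewrite eqxx.
  by move=> x; rewrite !inE => /andP[/negPf->].
rewrite (vertex_edge_countD1 vU) -sum_f (big_setD1 v) //= eqxx.
have -> : \sum_(x in U :\ v) (if x == v then 1 else f x + adj v x) =
    \sum_(x in U :\ v) f x + \sum_(x in U :\ v) adj v x.
  by rewrite -big_split; apply: eq_bigr => x /setD1P[/negPf->].
suff -> : \sum_(x in U :\ v) adj v x = #|nbrs U v| by lia.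
rewrite -sum1_card big_mkcond [RHS]big_mkcond; apply: eq_bigr => x _.
rewrite !inE; case: (boolP (adj v x)) => [/adj_neq|]; last first.
  by rewrite andbF; case: ifP.
by rewrite eq_sym andbT => ->.
Qed.

(** * From the painting game to the slow-coloring game *)

(** The score is the total number of marks, so a painting strategy that
respects the quotas [f] bounds it by the sum of [f]. *)
Lemma paintable_on_painter_within (G : sgraph) (f : G -> nat) (U : {set G}) :
  paintable_on f U -> painter_within (\sum_(v in U) f v) U.
Proof.
have [n] := ubnP (\sum_(v in U) f v); elim: n f U => // n IHn f U lt_n PU.
apply: painter_withinI => M [M0 MU]; have [f0 [I LI PI]] := paintable_onE PU MU.
have M_gt0 : 0 < #|M| by rewrite card_gt0.
have eq_f := sum_mark MU f0.
have eq_I := sum_setD (fun v => f v - (v \in M)) (subset_trans LI.1 MU).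
split; first by lia.
exists I => //; apply: painter_within_le (IHn _ _ _ PI); lia.
Qed.

(** If Lister marks [v] together with all its neighbors, a vertex with quota 1
must be colored in that round, and this forbids coloring any neighbor.  So
each neighbor loses one mark. *)
Lemma paintable_onD1 (G : sgraph) (f : G -> nat) (U : {set G}) (v : G) :
  paintable_on f U -> v \in U -> f v = 1 ->
  paintable_on (fun x => f x - (x \in v |: nbrs U v)) (U :\ v).
Proof.
move=> PU vU fv.
have [|_ [I [IM indI] PI]] := @paintable_onE _ _ _ (v |: nbrs U v) PU.
  by rewrite subUset sub1set vU; apply/subsetP => x; rewrite inE => /andP[].
have vI : v \in I.
  apply: contraT => vI; have vUI : v \in U :\: I by rewrite inE vI.
  by have := paintable_on_gt0 PI vUI; rewrite setU11 fv.
suff eqI : I = [set v] by rewrite eqI in PI.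
apply/setP => x; rewrite inE; apply/idP/eqP => [xI|->//].
have := subsetP IM _ xI; rewrite !inE => /orP[/eqP//|/andP[_ vx]].
by have := indI _ _ vI xI; rewrite vx.
Qed.

(** When every quota is at least 2, each vertex colored in the first round
leaves at least one mark unused.  If instead Painter can win after coloring
nothing in some round, then smaller quotas already suffice. *)
Lemma paintable_on_slack (G : sgraph) (f : G -> nat) (U : {set G}) (x : G) :
  paintable_on f U -> x \in U -> {in U, forall v, 1 < f v} ->
  exists2 k, k < \sum_(v in U) f v & painter_within k U.
Proof.
move=> PU xU f2.
(* If a mark can be answered by coloring nothing, those marks are spare. *)
have [[M [M0 MU] PM]|noM] := pselect (exists2 M, legal_mark U M &
    paintable_on (fun v => f v - (v \in M)) U).
  exists (\sum_(v in U) (f v - (v \in M))).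
    rewrite (sum_mark (f := f) MU) => [|v /(subsetP MU)/f2/ltnW //].
    by rewrite -addn1 leq_add2l card_gt0.
  exact: paintable_on_painter_within.
have sum_gt0 : 0 < \sum_(v in U) f v.
  by rewrite (big_setD1 x) //=; have := f2 _ xU; lia.
exists (\sum_(v in U) f v).-1; first by lia.
apply: painter_withinI => M LM; have [M0 MU] := LM.
have [f0 [I LI PI]] := paintable_onE PU MU.
have [I0|[y yI]] := set_0Vmem I.
  by case: noM; exists M; rewrite // -[U]setD0 -I0.
have yM := subsetP LI.1 _ yI; have yU := subsetP MU _ yM.
have eq_f := sum_mark MU f0.
have eq_I := sum_setD (fun v => f v - (v \in M)) (subset_trans LI.1 MU).
have gt_I : 0 < \sum_(v in I) (f v - (v \in M)).
  by rewrite (big_setD1 y) //= yM; have := f2 _ yU; lia.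
split; first by lia.
exists I => //; apply: painter_within_le (paintable_on_painter_within PI); lia.
Qed.

(** A vertex [v] with quota 1 can be removed by [paintable_onD1]: the total
quota and the count both drop by one plus the degree of [v], and Painter's
bound in the slow-coloring game grows by the same amount when [v] is put back.
Without such a vertex, [paintable_on_slack] gives the first alternative. *)
Lemma paintable_on_dichotomy (G : sgraph) (f : G -> nat) (U : {set G}) :
  paintable_on f U ->
  (exists2 k, k < \sum_(v in U) f v & painter_within k U) \/
  vertex_edge_count U <= \sum_(v in U) f v.
Proof.
have [n] := ubnP #|U|; elim: n f U => // n IHn f U ltUn PU.
have [->|[x xU]] := set_0Vmem U; first by right; rewrite vertex_edge_count0.
have [/exists_inP[v vU /eqP fv]|no1] := boolP [exists v in U, f v == 1];
  last first.
  left; apply: (paintable_on_slack PU xU) => v vU.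
  have := paintable_on_gt0 PU vU; rewrite leq_eqVlt => /orP[|//].
  by rewrite eq_sym => fv; case/exists_inP: no1; exists v.
have NU : v |: nbrs U v \subset U.
  by rewrite subUset sub1set vU; apply/subsetP => y; rewrite inE => /andP[].
have N0 y : y \in v |: nbrs U v -> 0 < f y.
  by move/(subsetP NU); apply: paintable_on_gt0.
have := sum_mark NU N0; rewrite (big_setD1 v (F := fun _ => _ - _)) //=.
rewrite setU11 fv add0n cardsU1 inE adj_irr andbF /= addnA => sum_f.
have [|[k lt_k Pk]|le_W] := IHn _ _ _ (paintable_onD1 PU vU fv).
- by rewrite (cardsD1 v U) vU in ltUn.
- left; exists (k + 1 + #|nbrs U v|); first by lia.
  exact: painter_within_extend Pk.
- by right; rewrite (vertex_edge_countD1 vU); lia.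
Qed.

(** * Induced paths on three vertices *)

Lemma painter_within_independent (G : sgraph) (U : {set G}) :
  independent U -> painter_within #|U| U.
Proof.
have [n] := ubnP #|U|; elim: n U => // n IHn U ltUn indU.
apply: painter_withinI => M [M0 MU]; split; first exact: subset_leq_card.
have M_gt0 : 0 < #|M| by rewrite card_gt0.
exists M; first by split=> // x y /(subsetP MU) xU /(subsetP MU); apply: indU.
have eqU : #|U :\: M| = #|U| - #|M| by rewrite cardsD (setIidPr MU).
rewrite -eqU; apply: IHn => [|x y /setDP[xU _] /setDP[yU _]]; last exact: indU.
by have := subset_leq_card MU; lia.
Qed.

(** Painter colors both ends if both are marked, leaving a cost of 1 after at
most 3 marks; otherwise colors the middle vertex if it is marked, leaving two
independent vertices after at most 2 marks; and otherwise colors the single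
marked end, leaving an edge, which costs 3. *)
Lemma painter_within_path3 (G : sgraph) (a b c : G) :
  adj a b -> adj b c -> a != c -> ~~ adj a c ->
  painter_within 4 [set a; b; c].
Proof.
move=> ab bc ac nac; have neq_ab := adj_neq ab; have neq_bc := adj_neq bc.
have ind_ac : independent [set a; c].
  move=> x y /set2P[]-> /set2P[]->; rewrite ?adj_irr //.
  by rewrite adj_sym.
have ind1 (x : G) : independent [set x].
  by move=> y z /set1P-> /set1P->; rewrite adj_irr.
have P_edge (x y : G) : x != y -> painter_within 3 [set x; y].
  move=> xy; rewrite -[3]/(1 + 1 + 1).
  apply: (@painter_within_extend _ _ _ _ x); rewrite ?set21 //.
    rewrite -(cards1 y); apply/subset_leq_card/subsetP => z; rewrite !inE.
    by case: eqP => [->|_] /=; [rewrite adj_irr|case/andP].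
  suff -> : [set x; y] :\ x = [set y].
    by rewrite -(cards1 y); apply: painter_within_independent.
  apply/setP => z; rewrite !inE; case: (eqVneq z x) => [->|] //=.
  exact/esym/negbTE.
have cardU : #|[set a; b; c]| = 3.
  by rewrite setUC cardsU1 !inE negb_or eq_sym ac eq_sym neq_bc cards2 neq_ab.
apply: painter_withinI => M [M0 MU].
have leM : #|M| <= 3 by rewrite -cardU subset_leq_card.
have M_gt0 : 0 < #|M| by rewrite card_gt0.
split; first exact: leq_trans leM _.
have [/andP[aM cM]|nacM] := boolP ((a \in M) && (c \in M)).
  exists [set a; c]; first by split; rewrite // subUset !sub1set aM.
  have -> : [set a; b; c] :\: [set a; c] = [set b].
    apply/setP => z; rewrite !inE.
    case: (eqVneq z a) => [->|za] //=; first by rewrite (negPf neq_ab).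
    case: (eqVneq z c) => [->|zc] //=; last by rewrite orbF.
    by rewrite eq_sym (negPf neq_bc).
  have := painter_within_independent (ind1 b); rewrite cards1.
  by apply: painter_within_le; lia.
have [bM|nbM] := boolP (b \in M).
  exists [set b]; first by split; rewrite ?sub1set.
  have -> : [set a; b; c] :\: [set b] = [set a; c].
    apply/setP => z; rewrite !inE; case: (eqVneq z b) => [->|] //=.
      by rewrite eq_sym (negPf neq_ab) (negPf neq_bc).
    by rewrite orbF.
  have ltM : #|M| < 3.
    rewrite -cardU; apply: proper_card; rewrite properE MU.
    apply: contra nacM => /subsetP UM; apply/andP.
    by split; apply: UM; rewrite !inE eqxx ?orbT.
  have := painter_within_independent ind_ac; rewrite cards2 ac.
  by apply: painter_within_le; lia.
(* Exactly one end z is marked; w is the other end. *)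
have [z [w [eqU zw zb bw Mz]]] : exists z w : G,
    [/\ [set a; b; c] = [set z; b; w], z != w, z != b, b != w & M = [set z]].
  have sub z w : M \subset [set z; b; w] -> w \notin M -> M = [set z].
    move=> Mzbw wM; apply/eqP; rewrite eqEcard cards1 M_gt0 andbT.
    apply/subsetP => y yM; have := subsetP Mzbw _ yM; rewrite !inE.
    case/orP => [/orP[//|]|] /eqP eq_y; move: yM; rewrite eq_y.
      by rewrite (negPf nbM).
    by rewrite (negPf wM).
  have [cM|cM] := boolP (c \in M); last first.
    by exists a, c; split=> //; apply: (sub a c).
  rewrite cM andbT in nacM.
  have eqU : [set a; b; c] = [set c; b; a].
    by rewrite setUC setUA (setUC [set c]) setUAC setUC setUA setUAC.
  exists c, a; split; rewrite // 1?eq_sym //.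
  by apply: (sub c a); rewrite -?eqU.
exists M; first by split; rewrite // Mz; apply: ind1.
rewrite eqU Mz cards1.
have -> : [set z; b; w] :\: [set z] = [set b; w].
  apply/setP => y; rewrite !inE; case: (eqVneq y z) => [->|] //=.
  by rewrite (negPf zb) (negPf zw).
exact: P_edge.
Qed.

(** Deleting the vertices outside the path reduces to the path, where the bound
4 of [painter_within_path3] beats the count 3 + 2; each vertex put back
raises the bound and the count equally. *)
Lemma painter_within_induced_path3 (G : sgraph) (U : {set G}) (a b c : G) :
  a \in U -> b \in U -> c \in U ->
  adj a b -> adj b c -> a != c -> ~~ adj a c ->
  exists2 k, k < vertex_edge_count U & painter_within k U.
Proof.
have [n] := ubnP #|U|; elim: n U => // n IHn U ltUn aU bU cU ab bc ac nac.
have abcU : [set a; b; c] \subset U by rewrite !subUset !sub1set aU bU.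
have [/eqP eqU|] := boolP (U == [set a; b; c]); last first.
  rewrite eq_sym eqEsubset abcU => /subsetPn[v vU].
  rewrite !inE !negb_or -andbA => /and3P[va vb vc].
  have memD x : x \in U -> v != x -> x \in U :\ v.
    by rewrite !inE eq_sym => -> ->.
  have [|k lt_k Pk] := IHn (U :\ v) _ (memD a aU va) (memD b bU vb)
    (memD c cU vc) ab bc ac nac; first by rewrite (cardsD1 v U) vU in ltUn.
  exists (k + 1 + #|nbrs U v|); last exact: painter_within_extend Pk.
  by rewrite (vertex_edge_countD1 vU); lia.
exists 4; last by rewrite eqU; apply: painter_within_path3.
have neq_bc := adj_neq bc; have neq_ab := adj_neq ab.
have U3 : #|U| = 3.
  by rewrite eqU setUC cardsU1 !inE negb_or eq_sym ac eq_sym neq_bc cards2 neq_ab.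
suff : 2 <= #|edges U| by rewrite /vertex_edge_count U3; lia.
have neq_e : [set a; b] != [set b; c].
  apply/eqP => /setP/(_ a); rewrite !inE eqxx /=.
  by rewrite (negPf neq_ab) (negPf ac).
apply: leq_trans (_ : #|[set [set a; b]; [set b; c]]| <= _).
  by rewrite cards2 neq_e.
apply/subset_leq_card; rewrite subUset !sub1set !inE.
rewrite !subUset !sub1set aU bU cU /=.
apply/andP; split; apply/existsP; [exists a|exists b]; apply/existsP.
  by exists b; rewrite ab eqxx.
by exists c; rewrite bc eqxx.
Qed.

(** * Disjoint unions of cliques *)

(** The absence of induced paths on three vertices; transitivity is asked for
distinct ends only, since adjacency is irreflexive. *)
Definition adj_transitive (G : sgraph) : Prop :=
  forall x y z : G, adj x y -> adj y z -> x != z -> adj x z.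

(** Transitive adjacency lets a connecting path be shortcut, one vertex at a
time, to a single edge. *)
Lemma components_completeP (G : sgraph) :
  (forall C : {set G}, C \in components G -> complete_on C) <->
  adj_transitive G.
Proof.
split=> [compl x y z xy yz xz|trans C].
  pose C := [set u in [set: G] | connect (@adj G) x u].
  have CC : C \in components G by apply/imsetP; exists x.
  apply: (compl C CC) => //; rewrite !inE ?connect0 //.
  exact: connect_trans (connect1 xy) (connect1 yz).
have conn x y : connect (@adj G) x y -> x != y -> adj x y.
  move=> /connectP[p]; elim: p x => [|z p IHp] x /= => [_ ->|].
    by rewrite eqxx.
  move=> /andP[xz pz] y_last xy; have [<-//|zy] := eqVneq z y.
  by apply: trans xz _ xy; apply: IHp.
move=> /imsetP[r _ ->] x y; rewrite !inE /= => rx ry; apply: conn.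
apply: connect_trans ry; rewrite (sym_connect_sym (@adj_sym G)) //.
Qed.

(** Lister marks the closed neighborhood [M] of any uncolored vertex.  It is a
clique and a union of components, so Painter colors at most one of its
vertices, of degree [#|M|.-1], and the count drops by at most the score [#|M|]
of the round. *)
Lemma vertex_edge_count_le (G : sgraph) (k : nat) (U : {set G}) :
  adj_transitive G -> painter_within k U -> vertex_edge_count U <= k.
Proof.
move=> trans; have [n] := ubnP k; elim: n k U => // n IHn k U lt_kn PU.
have [->|[v vU]] := set_0Vmem U; first by rewrite vertex_edge_count0.
pose M := v |: nbrs U v.
have MU : M \subset U.
  by rewrite subUset sub1set vU; apply/subsetP => x; rewrite inE => /andP[].
have M_gt0 : 0 < #|M| by rewrite card_gt0; apply/set0Pn; exists v; apply: setU11.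
have [le_k [I [IM indI] PI]] := painter_withinE PU MU.
have {PI} le_W : vertex_edge_count (U :\: I) <= k - #|M|.
  by apply: IHn PI; lia.
have adjM x y : x \in M -> y \in U -> x != y -> (y \in M) = adj x y.
  rewrite !inE => /orP[/eqP->|/andP[xU vx]] yU xy.
    by rewrite eq_sym (negPf xy) yU.
  rewrite yU /=; apply/orP/idP => [[/eqP->|vy]|xy'].
  - by rewrite adj_sym.
  - by apply: trans _ vy xy; rewrite adj_sym.
  - have [->|yv] := eqVneq y v; first by left.
    by right; apply: trans vx xy' _; rewrite eq_sym.
have [I0|[w wI]] := set_0Vmem I; first by rewrite I0 setD0 in le_W; lia.
have wM := subsetP IM _ wI; have wU := subsetP MU _ wM.
have eqI : I = [set w].
  apply/setP => x; rewrite inE; apply/idP/eqP => [xI|->//].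
  apply/eqP; apply: contraT => xw; have xM := subsetP IM _ xI.
  by have := indI _ _ xI wI; rewrite -adjM ?wM.
have eqN : nbrs U w = M :\ w.
  apply/setP => x; rewrite in_setD1 inE; have [->|xw] := eqVneq x w.
    by rewrite adj_irr andbF.
  have [xU|xU] := boolP (x \in U); last by rewrite (contraNF (subsetP MU x) xU).
  by rewrite (adjM w) // eq_sym.
rewrite (vertex_edge_countD1 wU) -eqI eqN.
by have := cardsD1 w M; rewrite wM; lia.
Qed.

Theorem theorem1p7 (G : sgraph) :
  sum_color_cost G = sum_paintability G <->
  (forall C : {set G}, C \in components G -> complete_on C).
Proof.
have [Ps Ls] := sum_color_costP G.
have cost_le k : painter_within k [set: G] -> sum_color_cost G <= k.
  by move=> Pk; apply: slow_coloring_le Pk Ls.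
have [f [f_gt0 Pf sum_f]] := sum_paintabilityP G.
have sumT (g : G -> nat) : \sum_(v in [set: G]) g v = \sum_v g v.
  by apply: eq_bigl => v; rewrite inE.
rewrite components_completeP; split=> [eq_s x y z xy yz xz|trans].
  apply: contraT => nxz.
  have [k lt_k /cost_le le_k] :=
    painter_within_induced_path3 (in_setT x) (in_setT y) (in_setT z)
      xy yz xz nxz.
  have := paintable_on_dichotomy Pf; rewrite sumT sum_f.
  by case=> [[l lt_l /cost_le]|]; lia.
have := cost_le _ (paintable_on_painter_within Pf); rewrite sumT sum_f.
have [g Pg] := paintable_on_vertex_edge_count [set: G]; rewrite sumT => sum_g.
have g_gt0 v : 0 < g v by apply: (paintable_on_gt0 Pg); rewrite inE.
have := sum_paintability_min g_gt0 Pg; rewrite sum_g.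
have := vertex_edge_count_le trans Ps; lia.
Qed.
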